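(* Let $p$ be a prime and let $r\ge1$, $s> 1$, $\lambda\ge0$ be integers. Let $N_c(s,1)$ denote the number of isomorphism classes of commutative rings with property (T), of characteristic $p$, with maximal Galois subfield $GF(p^r)$ and invariants $p,n,r,s,t,\lambda$ with $t=1$. Then $$N_c(s,1)=\begin{cases}\dfrac{3s-1}{2} & \text{if } s \text{ is odd},\\[2mm] \dfrac{3s}{2} & \text{if } s\text{ is even},\end{cases}$$ for any prime $p$.
   Context: All rings are finite, associative, with identity. A finite ring $R$ has property (T) if the set $M$ of all its zero-divisors (including $0$) is an ideal (so $R$ is completely primary with Jacobson radical $M$), $M^3=0$ and $M^2\ne 0$. Compatible matrices: for a finite field $F$, matrices $A_k=(a^k_{ij})\in M_s(F)$, $1\le k\le t$, are called compatible if they are linearly independent over $F$ and for each $i\in\{1,\dots,s\}$ there are $j,k$ with $a^k_{ij}\ne0$ or $a^k_{ji}\neq 0$. Let $F=GF(p^r)$. The maximal Galois subfield of such a ring is a coefficient subfield, isomorphic to $R/M$. The commutative rings with property (T), characteristic $p$ and maximal Galois subfield $F$ are, up to isomorphism, the rings of the following form (Construction A with trivial automorphisms and symmetric matrices): for $s\ge1$, $t\ge 1$, $\lambda\ge0$ and compatible symmetric matrices $A_1,\dots,A_t\in M_s(F)$, $A_k=(a^k_{ij})$, put $a_{ij}^k=0$ for $k>t$; let $U$ and $N$ be $F$-vector spaces with bases $u_1,\dots,u_s$ and $w_1,\dots,w_{t+\lambda}$; the ring is the $F$-algebra $F\oplus U\oplus N$ with identity $1\in F$, with $u_iu_j=\sum_k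 a^k_{ij}w_k$, $u_iw_k=w_ku_i=0$ and $w_kw_l=0$. A ring is said to have invariants $p,n,r,s,t,\lambda$ if it is isomorphic to such a ring with these parameters, where $n=1+s+t+\lambda$ (so its order is $p^{nr}$). Isomorphism means isomorphism of rings (not necessarily $F$-linear). *)

(* Defs.v *)
From HB Require Import structures.
From mathcomp Require Import all_boot all_order all_algebra.

Set Implicit Arguments.
Unset Strict Implicit.
Unset Printing Implicit Defensive.

Import GRing.Theory.
Local Open Scope ring_scope.

Definition ring_iso (R S : nzRingType) : Prop :=
  exists f : {rmorphism R -> S}, bijective f.

(* Since 1 != 0, the element 0 is a zero-divisor in this sense. *)
Definition zero_divisor (R : nzRingType) (x : R) : Prop :=
  exists2 y : R, y != 0 & (x * y = 0 \/ y * x = 0).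

Definition two_sided_ideal (R : nzRingType) (M : R -> Prop) : Prop :=
  [/\ M 0,
      forall x y, M x -> M y -> M (x - y)
    & forall a x, M x -> M (a * x) /\ M (x * a)].

(* The ideal powers M^3 and M^2 are the additive spans of products of three,
   resp. two, elements of M, so they vanish iff all these products do. *)
Definition property_T (R : nzRingType) : Prop :=
  let M := @zero_divisor R in
  [/\ two_sided_ideal M,
      forall x y z, M x -> M y -> M z -> x * y * z = 0
    & exists x y, [/\ M x, M y & x * y != 0]].

Definition is_subfield (R : finNzRingType) (K : {set R}) : Prop :=
  [/\ subring_closed K,
      {in K &, forall x y, x * y = y * x}
    & {in K, forall x, x != 0 -> exists2 y, y \in K & x * y = 1}].

(* In characteristic p the Galois subrings are the (finite) subfields. *)
Definition max_galois_subfield (R : finNzRingType) (K : {set R}) : Prop :=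
  is_subfield K /\
  forall L : {set R}, is_subfield L -> K \subset L -> L = K.

Definition has_max_galois_subfield (F : finFieldType) (R : finNzRingType) :
    Prop :=
  exists f : {rmorphism F -> R}, max_galois_subfield [set f a | a in [set: F]].

Definition compatible (F : fieldType) (s t : nat) (A : t.-tuple 'M[F]_s) :
    Prop :=
  free A /\
  forall i : 'I_s, exists (j : 'I_s) (k : 'I_t),
    tnth A k i j != 0 \/ tnth A k j i != 0.

(* The carrier F (+) U (+) N, with elements of U and N given by their
   coordinates in the bases (u_i) and (w_k). The matrices A are a parameter
   of the type because the multiplication depends on them. *)
Definition constrA (F : finFieldType) (s t lam : nat)
    (A : t.-tuple 'M[F]_s) : Type :=
  (F * 'rV[F]_s * 'rV[F]_(t + lam))%type.

Section ConstructionA.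
Variables (F : finFieldType) (s t lam : nat) (A : t.-tuple 'M[F]_s).

Local Notation T := (constrA lam A).

HB.instance Definition _ := Finite.on T.
HB.instance Definition _ := GRing.Zmodule.on T.

(* The bilinear product U x U -> N; the zero block expresses that the
   structure constants a^k_ij vanish for k > t. *)
Definition uprod (u v : 'rV[F]_s) : 'rV[F]_(t + lam) :=
  row_mx (\row_(k < t) \sum_i \sum_j u 0 i * v 0 j * tnth A k i j) 0.

Definition constrA_one : T := (1, 0, 0).

Definition constrA_mul (x y : T) : T :=
  let: (a, u, w) := x in
  let: (b, v, z) := y in
  (a * b, a *: v + b *: u, a *: z + b *: w + uprod u v).

Lemma uprodDl u u' v : uprod (u + u') v = uprod u v + uprod u' v.
Proof.
rewrite /uprod add_row_mx addr0; congr row_mx; apply/rowP=> k; rewrite !mxE.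
rewrite -big_split; apply: eq_bigr => i _; rewrite -big_split.
by apply: eq_bigr => j _; rewrite /= mxE !mulrDl.
Qed.

Lemma uprodDr u v v' : uprod u (v + v') = uprod u v + uprod u v'.
Proof.
rewrite /uprod add_row_mx addr0; congr row_mx; apply/rowP=> k; rewrite !mxE.
rewrite -big_split; apply: eq_bigr => i _; rewrite -big_split.
by apply: eq_bigr => j _; rewrite /= mxE mulrDr mulrDl.
Qed.

Lemma uprodZl a u v : uprod (a *: u) v = a *: uprod u v.
Proof.
rewrite /uprod scale_row_mx scaler0; congr row_mx; apply/rowP=> k.
rewrite !mxE mulr_sumr; apply: eq_bigr => i _; rewrite mulr_sumr.
by apply: eq_bigr => j _; rewrite mxE !mulrA.
Qed.

Lemma uprodZr a u v : uprod u (a *: v) = a *: uprod u v.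
Proof.
rewrite /uprod scale_row_mx scaler0; congr row_mx; apply/rowP=> k.
rewrite !mxE mulr_sumr; apply: eq_bigr => i _; rewrite mulr_sumr.
by apply: eq_bigr => j _; rewrite mxE !mulrA (mulrC _ a).
Qed.

Lemma uprod0l v : uprod 0 v = 0.
Proof. by rewrite -[0 in LHS](scale0r (0 : 'rV_s)) uprodZl scale0r. Qed.

Lemma uprod0r u : uprod u 0 = 0.
Proof. by rewrite -[0 in LHS](scale0r (0 : 'rV_s)) uprodZr scale0r. Qed.

Fact constrA_mulA : associative constrA_mul.
Proof.
case=> [[a u] w] [[b v] z] [[c x] y] /=.
rewrite !(uprodDl, uprodDr, uprodZl, uprodZr) !scalerDr !scalerA.
congr (_, _, _); first by rewrite mulrA.
  by rewrite addrA [c * a]mulrC [c * b]mulrC.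
rewrite [c * a]mulrC [c * b]mulrC -!addrA; do 2!congr (_ + _).
by rewrite addrCA; congr (_ + _); rewrite addrA addrC.
Qed.

Fact constrA_mul1l : left_id constrA_one constrA_mul.
Proof.
by case=> [[a u] w] /=; rewrite mul1r !scale1r !scaler0 uprod0l !addr0.
Qed.

Fact constrA_mul1r : right_id constrA_one constrA_mul.
Proof.
by case=> [[a u] w] /=; rewrite mulr1 !scale1r !scaler0 uprod0r !add0r addr0.
Qed.

Fact constrA_mulDl : left_distributive constrA_mul +%R.
Proof.
case=> [[a u] w] [[b v] z] [[c x] y].
rewrite /constrA_mul /= uprodDl !scalerDl !scalerDr mulrDl.
congr (_, _, _); rewrite /=; first by rewrite addrACA.
by rewrite [RHS]addrACA; congr (_ + _); rewrite addrACA.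
Qed.

Fact constrA_mulDr : right_distributive constrA_mul +%R.
Proof.
case=> [[a u] w] [[b v] z] [[c x] y].
rewrite /constrA_mul /= uprodDr !scalerDl !scalerDr mulrDr.
congr (_, _, _); rewrite /=; first by rewrite addrACA.
by rewrite [RHS]addrACA; congr (_ + _); rewrite addrACA.
Qed.

Fact constrA_1neq0 : constrA_one != 0.
Proof. by apply/eqP => -[/eqP]; rewrite oner_eq0. Qed.

HB.instance Definition _ := GRing.Zmodule_isNzRing.Build T
  constrA_mulA constrA_mul1l constrA_mul1r constrA_mulDl constrA_mulDr
  constrA_1neq0.

End ConstructionA.

Definition has_invariants (F : finFieldType) (n s t lam : nat)
    (R : nzRingType) : Prop :=
  [/\ (0 < s)%N, (0 < t)%N, n = (1 + s + t + lam)%N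
    & exists A : t.-tuple 'M[F]_s,
        [/\ compatible A,
            forall k : 'I_t, (tnth A k)^T = tnth A k
          & ring_iso R (constrA lam A)]].

Definition comm_T_ring (p : nat) (F : finFieldType) (n s t lam : nat)
    (R : finNzRingType) : Prop :=
  [/\ commutative (@GRing.mul R),
      property_T R,
      p \in [pchar R],
      has_max_galois_subfield F R
    & has_invariants F n s t lam R].

(* The class of rings satisfying P consists of exactly N isomorphism classes:
   the R_ i form a system of representatives. *)
Definition num_iso_classes (P : finNzRingType -> Prop) (N : nat) : Prop :=
  exists R_ : 'I_N -> finNzRingType,
    [/\ forall i, P (R_ i),
        forall i j, ring_iso (R_ i) (R_ j) -> i = j
      & forall R, P R -> exists i, ring_iso R (R_ i)].

(* Main.v *)
Require Import Defs.
From HB Require Import structures.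
From mathcomp Require Import all_boot all_order all_algebra finfield ring zify.

(** When t = 1 the ring is determined by one nonzero symmetric matrix A, and
    two rings are isomorphic iff their matrices agree up to congruence, a scalar
    and an automorphism of F: the products of nilpotent elements form the line
    M^2, which any isomorphism maps semilinearly.  (A ring isomorphism need not
    induce an invertible map of U, because the radical of the form may be mixed
    with N; this is why [semisim] below allows a non-invertible matrix, and is
    used in both directions.)  Over a finite field every nonalternating symmetric
    matrix is congruent to diag(1, ..., 1, a, 0, ..., 0), since b x^2 + c y^2
    represents 1, and an alternating one to a sum of hyperbolic planes.  Up to
    scalars this leaves one class for each odd rank and two for each even rank:
    in odd characteristic they are separated by the discriminant modulo squares,
    in characteristic 2 by being alternating or not.  Hence there are
    s + floor(s / 2) classes.  Finally, a nonzero matrix of any rank is congruent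
    to one with no zero row, so compatibility excludes no class. *)

(** * Congruence of symmetric matrices and orthogonal splitting *)

Section SymmetricForms.
Set Implicit Arguments.
Unset Strict Implicit.
Unset Printing Implicit Defensive.
Import GRing.Theory.
Local Open Scope ring_scope.

Variable F : finFieldType.

Definition cong n (A B : 'M[F]_n) :=
  exists2 P, P \in unitmx & P *m A *m P^T = B.

Lemma cong_refl n (A : 'M[F]_n) : cong A A.
Proof. by exists 1%:M; rewrite ?unitmx1 // trmx1 mul1mx mulmx1. Qed.

Lemma cong_trans n (A B C : 'M[F]_n) : cong A B -> cong B C -> cong A C.
Proof.
move=> [P uP <-] [Q uQ <-]; exists (Q *m P); first by rewrite unitmx_mul uQ.
by rewrite trmx_mul !mulmxA.
Qed.

Lemma cong_sym n (A B : 'M[F]_n) : cong A B -> cong B A.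
Proof.
move=> [P uP <-]; exists (invmx P); first by rewrite unitmx_inv.
by rewrite trmx_inv !mulmxA mulVmx // mul1mx mulmxK // unitmx_tr.
Qed.

Lemma cong_tr n (A B : 'M[F]_n) : cong A B -> A^T = A -> B^T = B.
Proof. by move=> [P _ <-] sA; rewrite !trmx_mul trmxK sA mulmxA. Qed.

Lemma cong_rank n (A B : 'M[F]_n) : cong A B -> \rank B = \rank A.
Proof.
move=> [P uP <-]; rewrite mxrankMfree ?row_free_unit ?unitmx_tr //.
by rewrite -mxrank_tr trmx_mul mxrankMfree ?mxrank_tr ?row_free_unit ?unitmx_tr.
Qed.

Lemma cong_scale n (a : F) (A B : 'M[F]_n) :
  cong A B -> cong (a *: A) (a *: B).
Proof. by move=> [P uP <-]; exists P; rewrite // -scalemxAr -scalemxAl. Qed.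

Lemma cong_block k n (G : 'M[F]_k) (A B : 'M[F]_n) :
  cong A B -> cong (block_mx G 0 0 A) (block_mx G 0 0 B).
Proof.
move=> [P uP <-]; exists (block_mx 1%:M 0 0 P).
  by rewrite unitmxE det_ublock det1 mul1r.
rewrite tr_block_mx trmx1 !trmx0 !mulmx_block.
by rewrite !(mulmx0, mul0mx, addr0, add0r, mul1mx, mulmx1).
Qed.

(** In the factorization of [M] through [col_ebase M] and [row_ebase M], enlarging the left factor
    by an identity block turns [M] into the top of an invertible matrix. *)
Lemma row_free_completion k n (M : 'M[F]_(k, k + n)) :
  row_free M -> exists2 P, P \in unitmx & usubmx P = M.
Proof.
move=> fM; have rM : \rank M = k by apply/eqP.
exists (block_mx (col_ebase M) 0 0 1%:M *m row_ebase M).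
  rewrite unitmx_mul row_ebase_unit andbT unitmxE det_ublock det1 mulr1 -unitmxE.
  exact: col_ebase_unit.
rewrite -mul_usub_mx /block_mx col_mxKu -[RHS]mulmx_ebase rM pid_mx_row.
by rewrite mul_mx_row mulmx1 mulmx0.
Qed.

(** The rows of [M] span a subspace on which the form is nondegenerate, so it has an orthogonal
    complement; [A'] is the Gram matrix there. *)
Lemma cong_split k n (A : 'M[F]_(k + n)) (M : 'M_(k, k + n)) :
    A^T = A -> M *m A *m M^T \in unitmx ->
  exists2 P, P \in unitmx & usubmx P = M /\
    exists2 A' : 'M_n, A'^T = A' &
      P *m A *m P^T = block_mx (M *m A *m M^T) 0 0 A'.
Proof.
move=> sA uG; set G := M *m A *m M^T in uG *.
(* An invertible Gram matrix forces the rows of [M] to be independent. *)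
have [Q uQ QM] : exists2 P, P \in unitmx & usubmx P = M.
  apply: row_free_completion; rewrite /row_free eqn_leq rank_leq_row /=.
  by rewrite -{1}(mxrank_unit uG) /G -mulmxA mxrankM_maxl.
have sG : G^T = G by rewrite !trmx_mul trmxK sA mulmxA.
set N := dsubmx Q; have QE : Q = col_mx M N by rewrite -QM vsubmxK.
(* Gram-Schmidt: adding [L *m M] removes from the rows of [N] their projection to the span of
   [M]. *)
set L := - (N *m A *m M^T *m invmx G).
have uL : block_mx 1%:M 0 L 1%:M \in unitmx.
  by rewrite unitmxE det_lblock !det1 mulr1 unitr1.
set P := block_mx 1%:M 0 L 1%:M *m Q.
have PE : P = col_mx M (L *m M + N).
  by rewrite /P QE mul_block_col mul1mx mul0mx addr0 mul1mx.
exists P; first by rewrite unitmx_mul uL.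
split; first by rewrite PE col_mxKu.
have dl : (L *m M + N) *m A *m M^T = 0.
  rewrite !mulmxDl -2!mulmxA [M *m _]mulmxA -/G mulNmx mulmxKV //.
  by rewrite addNr.
have ur : M *m A *m (L *m M + N)^T = 0.
  by rewrite -[RHS]trmx0 -dl !trmx_mul !trmxK sA mulmxA.
exists ((L *m M + N) *m A *m (L *m M + N)^T).
  by rewrite !trmx_mul trmxK sA mulmxA.
by rewrite PE tr_col_mx mul_col_mx mul_col_row dl ur.
Qed.

Definition alternating n (A : 'M[F]_n) := forall v : 'rV_n, v *m A *m v^T = 0.

Lemma alternatingPn n (A : 'M[F]_n) :
  alternating A \/ exists v : 'rV_n, v *m A *m v^T != 0.
Proof.
have [/existsP|] := boolP [exists v : 'rV_n, v *m A *m v^T != 0]; first by right.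
by rewrite negb_exists => /forallP h; left=> v; have:= h v; rewrite negbK => /eqP.
Qed.

Lemma cong_alternating n (A B : 'M[F]_n) :
  cong A B -> alternating A -> alternating B.
Proof.
move=> [P _ <-] aA v.
by have:= aA (v *m P); rewrite trmx_mul !mulmxA.
Qed.

Lemma row_form n (A : 'M[F]_n) i j :
  delta_mx 0 i *m A *m (delta_mx 0 j)^T = (A i j)%:M :> 'M_1.
Proof.
by rewrite -rowE trmx_delta -colE; apply/matrixP=> k l; rewrite !ord1 !mxE eqxx.
Qed.

(** Polarization: the value at the sum of two basis vectors is twice an entry of [A]. *)
Lemma alternating_eq0 n (A : 'M[F]_n) :
  2%:R != 0 :> F -> A^T = A -> alternating A -> A = 0.
Proof.
move=> two sA aA; apply/matrixP=> i j; rewrite mxE.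
have := aA (delta_mx 0 i + delta_mx 0 j).
rewrite linearD /= !(mulmxDl, mulmxDr) !aA addr0 add0r !row_form.
have -> : A j i = A i j by rewrite -[in RHS]sA mxE.
move=> /matrixP /(_ 0 0); rewrite !mxE /= => /eqP.
by rewrite -mulr2n -mulr_natl mulf_eq0 (negbTE two) => /eqP.
Qed.

Lemma mx11_unit (M : 'M[F]_1) : (M \in unitmx) = (M != 0).
Proof.
rewrite unitmxE [M]mx11_scalar det_scalar1 unitfE; congr (~~ _).
by apply/eqP/eqP=> [->|/matrixP/(_ 0 0)]; rewrite ?scalemx1 ?raddf0 // !mxE.
Qed.

(** * Squares in a finite field *)

Definition squares : {set F} := [set x ^+ 2 | x : F].

(** The fibres of squaring have at most two elements and the fibre of 0 has one; this makes the
    inequality strict. *)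
Lemma card_squares : (#|F| < #|squares| * 2)%N.
Proof.
have -> : #|F| = (\sum_(y in squares) #|[set x : F | x ^+ 2 == y]|)%N.
  rewrite -sum1_card (partition_big (fun x : F => x ^+ 2) [in squares]) /=.
    by apply: eq_bigr => y _; rewrite -sum1_card; apply: eq_bigl => x; rewrite inE.
  by move=> x _; apply: imset_f.
have s0 : 0 \in squares by apply/imsetP; exists 0; rewrite ?expr0n.
rewrite (bigD1 0) //= (_ : [set x : F | _] = [set 0]); last first.
  by apply/setP=> x; rewrite !inE expf_eq0.
rewrite cards1 (cardsD1 0 squares) s0 /= mulnDl -sum_nat_const.
rewrite mul1n add1n !addSn add0n !ltnS.
rewrite [leqLHS](eq_bigl [in squares :\ 0]); last by move=> y; rewrite !inE andbC.
apply: leq_sum => _ /setD1P[_ /imsetP[z _ ->]].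
apply: leq_trans (_ : #|[set z; - z]| <= 2)%N; last by rewrite cards2; case: eqP.
by apply/subset_leq_card/subsetP=> x; rewrite !inE eqf_sqr.
Qed.

Lemma pigeonhole (A B : {set F}) :
  (#|F| < #|A| + #|B|)%N -> exists2 x, x \in A & x \in B.
Proof.
move=> h; case: (pickP [in A :&: B]) => [x /setIP[]|AB0]; first by exists x.
have /setP AB : A :&: B =i set0 by move=> x; rewrite AB0 inE.
have: (#|A :|: B| <= #|F|)%N by apply: max_card.
by rewrite cardsU (_ : A :&: B = set0) ?cards0 ?subn0 1?leqNgt ?h //; apply/setP.
Qed.

(** The values of [b * x ^+ 2] and those of [1 - c * y ^+ 2] each fill more than half of [F], so
    they meet. *)
Lemma two_squares (b c : F) :
  b != 0 -> c != 0 -> exists x y, b * x ^+ 2 + c * y ^+ 2 = 1.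
Proof.
move=> b0 c0.
have [|_ /imsetP[_ /imsetP[x _ ->] ->] /imsetP[_ /imsetP[y _ ->] e]] :=
  @pigeonhole [set b * z | z in squares] [set 1 - c * z | z in squares].
  rewrite !(card_imset (mem squares)) //; first by rewrite addnn -muln2 card_squares.
  - by move=> z t /addrI /oppr_inj /(mulfI c0).
  - exact: mulfI.
by exists x, y; rewrite e subrK.
Qed.

(** The squares and the nonzero multiples of squares by [e] are disjoint sets, and by [card_squares]
    together they exhaust [F]. *)
Lemma square_or (e a : F) : e \notin squares -> a != 0 ->
  exists2 t, t != 0 & a = t ^+ 2 \/ a = e * t ^+ 2.
Proof.
move=> eS a0.
have e0 : e != 0.
  by apply: contraNneq eS => ->; apply/imsetP; exists 0; rewrite ?expr0n.
have [aS|aS] := boolP (a \in squares).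
  have /imsetP[t _ at2] := aS; exists t; last by left.
  by apply: contraNneq a0 => t0; rewrite at2 t0 expr0n.
pose T := [set e * z | z in squares :\ 0].
have dis : squares :&: T = set0.
  apply/setP=> y; rewrite !inE; apply: contraNF eS.
  move=> /andP[/imsetP[u _ ->] /imsetP[z /setD1P[v0 /imsetP[v _ vE]] uv]].
  rewrite vE in v0 uv; apply/imsetP; exists (u / v) => //.
  by rewrite expr_div_n uv mulfK.
have [|y] := @pigeonhole (squares :|: T) [set a].
  rewrite cardsU dis cards0 subn0 cards1 (card_imset _ (mulfI e0)).
  have := card_squares; rewrite (cardsD1 0 squares).
  have -> : 0 \in squares by apply/imsetP; exists 0; rewrite ?expr0n.
  by rewrite muln2 -addnn [(_ + (true + _))%N]addnCA addnA addnA addn1 !add1n.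
rewrite !inE => h /eqP ya; move: h; rewrite {}ya (negbTE aS) /=.
move=> /imsetP[z /setD1P[z0 /imsetP[v _ zE]] ->]; exists v; last first.
  by right; rewrite zE.
by apply: contraNneq z0 => v0; rewrite zE v0 expr0n.
Qed.

(** * Diagonal normal form of nonalternating symmetric matrices *)

Lemma form_block k n (G : 'M[F]_k) (A : 'M[F]_n) (x x' : 'rV_k) (y y' : 'rV_n) :
  row_mx x y *m block_mx G 0 0 A *m (row_mx x' y')^T
  = x *m G *m x'^T + y *m A *m y'^T.
Proof.
by rewrite tr_row_mx mul_row_block !mulmx0 addr0 add0r mul_row_col.
Qed.

(** The last clause carries values of the form from the complement of [v] over to [A']; it serves to
    show that [A'] is nonalternating. *)
Lemma cong_split1 n (A : 'M[F]_(1 + n)) (v : 'rV_(1 + n)) (c : F) :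
    A^T = A -> v *m A *m v^T = c%:M -> c != 0 ->
  exists A' : 'M_n, [/\ A'^T = A', cong A (block_mx c%:M 0 0 A')
    & forall u : 'rV_(1 + n), u *m A *m v^T = 0 ->
      exists y : 'rV_n, y *m A' *m y^T = u *m A *m u^T].
Proof.
move=> sA vc c0.
have uG : v *m A *m v^T \in unitmx.
  by rewrite vc mx11_unit -scalemx1 scaler_eq0 negb_or c0 matrix_nonzero1.
have [P uP [Pv [A' sA' PA]]] := cong_split sA uG.
exists A'; split=> //; first by exists P; rewrite // PA vc.
move=> u uv0; exists (rsubmx (u *m invmx P)).
have [x uE] : exists x, u = x *m P by exists (u *m invmx P); rewrite mulmxKV.
have vE : v = row_mx 1%:M 0 *m P.
  by rewrite -[P in RHS]vsubmxK Pv mul_row_col mul1mx mul0mx addr0.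
have formP (y z : 'rV_(1 + n)) :
    (y *m P) *m A *m (z *m P)^T = y *m block_mx c%:M 0 0 A' *m z^T.
  by rewrite trmx_mul -vc -PA !mulmxA.
move: uv0; rewrite {}uE mulmxK // vE !formP -[x]hsubmxK !form_block row_mxKr.
rewrite trmx1 trmx0 mulmx0 addr0 mulmx1 mul_mx_scalar => /eqP.
by rewrite scaler_eq0 (negbTE c0) /= => /eqP ->; rewrite scaler0 mul0mx add0r.
Qed.

(** An arbitrary splitting may leave an alternating remainder and block the induction. After a first
    splitting, a vector [v] of value 1 is therefore chosen together with a vector [u] orthogonal to
    it of nonzero value. *)
Lemma nonalternating_split n (A : 'M[F]_(1 + n)) :
    A^T = A -> (exists v : 'rV_(1 + n), v *m A *m v^T != 0) ->
  exists b (A' : 'M_n), [/\ b != 0, A'^T = A', cong A (block_mx b%:M 0 0 A')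
    & A' = 0 \/ b = 1 /\ exists v : 'rV_n, v *m A' *m v^T != 0].
Proof.
move=> sA [v0]; set c0 := (v0 *m A *m v0^T) 0 0.
have v0E : v0 *m A *m v0^T = c0%:M by rewrite -mx11_scalar.
rewrite v0E -scalemx1 scaler_eq0 negb_or => /andP[nz_c0 _].
have [A0 [sA0 cA0 _]] := cong_split1 sA v0E nz_c0.
have [A00|nzA0] := eqVneq A0 0; first by exists c0, A0; split=> //; left.
set B := block_mx _ _ _ _ in cA0.
have sB : B^T = B by apply: cong_tr cA0 sA.
suff [v [u [v1 uv uu]]] : exists v u : 'rV_(1 + n),
    [/\ v *m B *m v^T = 1%:M, u *m B *m v^T = 0 & u *m B *m u^T != 0].
  have [A' [sA' cA' hA']] := cong_split1 sB v1 (oner_neq0 F).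
  exists 1, A'; split=> //; first exact: oner_neq0.
    exact: cong_trans cA0 cA'.
  by right; split=> //; have [y yE] := hA' u uv; exists y; rewrite yE.
have [aA0|[w]] := alternatingPn A0.
  have two : 2%:R = 0 :> F.
    by apply: contraNeq nzA0 => two; apply/eqP/alternating_eq0.
  (* In characteristic 2 squaring is additive, so the two squares merge into one. *)
  have [x xE] : exists x, c0 * x ^+ 2 = 1.
    have [x [y <-]] := two_squares nz_c0 nz_c0; exists (x + y).
    by rewrite sqrrD -mulr_natl two mul0r addr0 mulrDr.
  have /matrix0Pn[i [j dij]] := nzA0.
  pose e k : 'rV[F]_n := delta_mx 0 k.
  (* The alternating block adds nothing to the values, which are 1 and [c0]; the coefficient of
     [e i] makes the two vectors orthogonal. *)
  exists (row_mx x%:M (e j)), (row_mx 1%:M ((- (c0 * x / A0 i j)) *: e i)).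
  rewrite !form_block !linearZ /= -!scalemxAl -?scalemxAr !aA0 !scaler0 !addr0.
  rewrite row_form !tr_scalar_mx -!scalar_mxM !mul1r !mulr1; split.
  - by rewrite -xE mulrAC mulrC expr2 mulrA.
  - by rewrite scale_scalar_mx -raddfD mulNr divfK // subrr raddf0.
  - by rewrite -scalemx1 scaler_eq0 negb_or nz_c0 matrix_nonzero1.
set c := (w *m A0 *m w^T) 0 0.
have wE : w *m A0 *m w^T = c%:M by rewrite -mx11_scalar.
rewrite wE -scalemx1 scaler_eq0 negb_or => /andP[nz_c _].
have [x [y xyE]] := two_squares nz_c0 nz_c.
(* In the plane with form diag(c0, c), the second vector is orthogonal to the first, and its value
   is [c0 * c] times the value 1 of the first. *)
exists (row_mx x%:M (y *: w)), (row_mx (- (c * y))%:M ((c0 * x) *: w)).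
rewrite !form_block !linearZ /= -!scalemxAl -?scalemxAr wE.
rewrite !tr_scalar_mx !scale_scalar_mx -!scalar_mxM -!raddfD /=; split.
- by congr (_%:M); rewrite -xyE; ring.
- by rewrite [X in X%:M](_ : _ = 0) ?raddf0 //; ring.
- rewrite [X in X%:M](_ : _ = c0 * c * (c0 * x ^+ 2 + c * y ^+ 2)); last by ring.
  by rewrite xyE mulr1 -scalemx1 scaler_eq0 negb_or mulf_neq0 ?matrix_nonzero1.
Qed.

(** The entry [a] follows [rho] ones, so for nonzero [a] and [rho < n] the rank is [rho.+1]. *)
Definition nf n rho (a : F) : 'M_n :=
  diag_mx (\row_i (if (i < rho)%N then 1 else if i == rho :> nat then a else 0)).

Lemma nfS n rho a :
  nf n.+1 rho.+1 a = block_mx (1%:M : 'M_1) 0 0 (nf n rho a) :> 'M_(1 + n).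
Proof.
rewrite /nf -(diag_const_mx 1) -diag_mx_row; congr diag_mx.
by apply/rowP=> i; rewrite !mxE; case: splitP => j ->; rewrite !mxE ?ord1.
Qed.

Lemma nf0 n a : nf n.+1 0 a = block_mx (a%:M : 'M_1) 0 0 0 :> 'M_(1 + n).
Proof.
rewrite /nf -diag_const_mx -(raddf0 (@diag_mx F n)) -diag_mx_row; congr diag_mx.
by apply/rowP=> i; rewrite !mxE; case: splitP => j ->; rewrite !mxE ?ord1.
Qed.

Lemma tr_nf n rho a : (nf n rho a)^T = nf n rho a.
Proof. exact: tr_diag_mx. Qed.

Lemma rank_nf n rho a : (rho < n)%N -> a != 0 -> \rank (nf n rho a) = rho.+1.
Proof.
elim: n rho => // n IHn [|rho] lt_rho nz_a.
  rewrite nf0 (@rank_diag_block_mx _ 1 1 n n) mxrank0 addn0 mxrank_unit //.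
  by rewrite mx11_unit -scalemx1 scaler_eq0 negb_or nz_a matrix_nonzero1.
by rewrite nfS (@rank_diag_block_mx _ 1 1 n n) mxrank1 IHn.
Qed.

Lemma cong_nf_sqr n rho a t : t != 0 -> cong (nf n rho a) (nf n rho (a * t ^+ 2)).
Proof.
move=> nz_t; pose d : 'rV_n := \row_i (if i == rho :> nat then t else 1).
exists (diag_mx d).
  rewrite unitmxE det_diag unitfE; apply/prodf_neq0 => i _.
  by rewrite mxE; case: ifP => _ //; apply: oner_neq0.
rewrite tr_diag_mx !mulmx_diag; congr diag_mx; apply/rowP=> i; rewrite !mxE.
by case: ltngtP => _; ring.
Qed.

Lemma nonalternating_nf n (A : 'M[F]_n) :
    A^T = A -> (exists v : 'rV_n, v *m A *m v^T != 0) ->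
  exists rho a, [/\ (rho < n)%N, a != 0 & cong A (nf n rho a)].
Proof.
elim: n A => [|n IHn] A sA vA.
  by case: vA => v; rewrite thinmx0 !mul0mx eqxx.
have [b [A' [nz_b sA' cA' [A'0|[b1 vA']]]]] := nonalternating_split sA vA.
  by exists 0%N, b; split=> //; rewrite nf0 -A'0.
have [rho [a [lt_rho nz_a cA]]] := IHn A' sA' vA'.
exists rho.+1, a; split=> //; rewrite nfS.
by apply: cong_trans cA' _; rewrite b1; apply: cong_block.
Qed.

(** The discriminant modulo squares, for a [Q] that may be singular: only its upper left block of
    size [rho.+1] meets the nonzero parts, and [d] is the determinant of that block. *)
Lemma nf_det n rho (a b c : F) (Q : 'M_n) :
    (rho < n)%N -> Q *m nf n rho a *m Q^T = c *: nf n rho b ->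
  exists d, d ^+ 2 * a = c ^+ rho.+1 * b.
Proof.
move=> lt_rho; have [m nE] : exists m, n = (rho.+1 + m)%N.
  by exists (n - rho.+1)%N; rewrite subnKC.
move: Q; rewrite {}nE {lt_rho} => Q.
have nf_block x : nf (rho.+1 + m) rho x = block_mx (nf rho.+1 rho x) 0 0 0.
  rewrite /nf -(raddf0 (@diag_mx F m)) -diag_mx_row; congr diag_mx.
  apply/rowP=> i; rewrite !mxE; case: splitP => j ->; rewrite !mxE //.
  by case: ltngtP => //; lia.
have det_nf x : \det (nf rho.+1 rho x) = x.
  rewrite det_diag big_ord_recr /= mxE ltnn eqxx big1 ?mul1r // => i _.
  by rewrite mxE /= ltn_ord.
rewrite !nf_block -[Q]submxK tr_block_mx !mulmx_block scale_block_mx.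
move=> /eq_block_mx[]; rewrite !(mulmx0, mul0mx, addr0) => /(congr1 determinant).
rewrite !det_mulmx det_tr detZ !det_nf => e _ _ _.
by exists (\det (ulsubmx Q)); rewrite -e expr2 mulrAC.
Qed.

(** * Alternating matrices and hyperbolic planes *)

Definition hyp : 'M[F]_(1 + 1) := block_mx 0 1%:M 1%:M 0.

(** A sum of [m] hyperbolic planes padded by zeros. It stops early when fewer than two rows remain,
    hence the bound on [m] in [rank_symp]. *)
Fixpoint symp n m {struct m} : 'M[F]_n :=
  match m, n return 'M[F]_n with
  | m'.+1, n'.+2 => block_mx hyp 0 0 (symp n' m') : 'M_(2 + n')
  | _, _ => 0
  end.

Lemma tr_symp n m : (symp n m)^T = symp n m.
Proof.
elim: m n => [|m IHm] [|[|n]] /=; rewrite ?trmx0 //.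
by rewrite (@tr_block_mx _ (1 + 1) n (1 + 1) n) IHm !trmx0 tr_block_mx !trmx0 !trmx1.
Qed.

Lemma hyp_unit : hyp \in unitmx.
Proof.
have /mulmx1_unit[] // : hyp *m hyp = 1%:M.
rewrite mulmx_block !(mulmx0, mul0mx, mulmx1, addr0, add0r).
by rewrite -scalar_mx_block.
Qed.

Lemma rank_symp n m : (m.*2 <= n)%N -> \rank (symp n m) = m.*2.
Proof.
elim: m n => [|m IHm] [|[|n]] //= lt_m; rewrite ?mxrank0 //.
by rewrite (@rank_diag_block_mx _ (1 + 1) (1 + 1) n n) IHm // mxrank_unit ?hyp_unit.
Qed.

Lemma alternating_block k n (G : 'M[F]_k) (A : 'M[F]_n) :
  alternating G -> alternating A -> alternating (block_mx G 0 0 A).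
Proof. by move=> aG aA v; rewrite -[v]hsubmxK form_block aG aA addr0. Qed.

Lemma hyp_alternating : 2%:R = 0 :> F -> alternating hyp.
Proof.
move=> two v; rewrite -[v]hsubmxK tr_row_mx mul_row_block.
rewrite !(mulmx0, mulmx1, addr0, add0r) mul_row_col.
set y := lsubmx v; set z := rsubmx v.
have -> : z *m y^T = y *m z^T.
  by rewrite [LHS]mx11_scalar [RHS]mx11_scalar !mxE !big_ord1 !mxE mulrC.
by rewrite -mulr2n -scaler_nat two scale0r.
Qed.

Lemma symp_alternating n m : 2%:R = 0 :> F -> alternating (symp n m).
Proof.
move=> two; elim: m n => [|m IHm] [|[|n]] /=;
  try by move=> v; rewrite mulmx0 mul0mx.
exact: alternating_block (hyp_alternating two) (IHm n).
Qed.

(** A nonzero entry yields two vectors with Gram matrix [hyp]; splitting off their plane lowers the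
    size by two. *)
Lemma alternating_symp n (A : 'M[F]_n) :
    A^T = A -> alternating A ->
  exists2 m, (m.*2 <= n)%N & cong A (symp n m).
Proof.
elim/ltn_ind: n A => n IHn A sA aA.
have [->|nzA] := eqVneq A 0; first by exists 0%N; last exact: cong_refl.
have /matrix0Pn[i [j dij]] := nzA.
case: n => [|[|n]] in IHn A sA aA nzA i j dij *; first by case: i dij.
  have /matrixP/(_ 0 0) := aA (delta_mx 0 i); rewrite row_form.
  by rewrite !ord1 !mxE in dij * => /eqP; rewrite (negbTE dij).
pose u : 'rV[F]_(2 + n) := (A i j)^-1 *: delta_mx 0 i.
pose v : 'rV[F]_(2 + n) := delta_mx 0 j.
have uv : u *m A *m v^T = 1%:M.
  by rewrite -!scalemxAl row_form scale_scalar_mx mulVf.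
have vu : v *m A *m u^T = 1%:M.
  by rewrite -[RHS]trmx1 -uv !trmx_mul trmxK sA mulmxA.
pose M : 'M[F]_(1 + 1, 2 + n) := col_mx u v.
have ME : M *m A *m M^T = hyp.
  by rewrite tr_col_mx mul_col_mx mul_col_row uv vu !aA.
have [|P uP [_ [A' sA' PA]]] := @cong_split 2 n A M sA.
  by rewrite ME hyp_unit.
have cA : cong A (block_mx hyp 0 0 A') by exists P; rewrite // PA ME.
have [||m lt_m cA'] := IHn n _ A' sA'; first by lia.
  have aB : alternating (block_mx hyp 0 0 A') := cong_alternating cA aA.
  by move=> y; have := aB (row_mx 0 y); rewrite form_block !mul0mx add0r.
exists m.+1; first by rewrite doubleS !ltnS.
exact: cong_trans cA (cong_block hyp cA').
Qed.

(** * Classes up to scalars and field automorphisms *)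

Definition csim n (A B : 'M[F]_n) := exists2 c, c != 0 & cong A (c *: B).

(** Ring isomorphism will lie between [csim], which implies it, and [semisim], which follows from
    it. Representatives are thus sought that are exhaustive for [csim] and distinct for mutual
    [semisim]. *)
Definition semisim n (A B : 'M[F]_n) :=
  exists (sigma : {rmorphism F -> F}) (c : F) (Q : 'M_n),
    c != 0 /\ Q *m B *m Q^T = c *: map_mx sigma A.

Lemma cong_csim n (A B : 'M[F]_n) : cong A B -> csim A B.
Proof. by exists 1; rewrite ?oner_neq0 ?scale1r. Qed.

Lemma csim_trans n (A B C : 'M[F]_n) : csim A B -> csim B C -> csim A C.
Proof.
move=> [c nz_c cAB] [d nz_d cBC]; exists (c * d); first exact: mulf_neq0.
by apply: cong_trans cAB _; rewrite -scalerA; apply: cong_scale.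
Qed.

Lemma semisim_rank n (A B : 'M[F]_n) : semisim A B -> (\rank A <= \rank B)%N.
Proof.
move=> [sigma [c [Q [nz_c QB]]]].
rewrite -(mxrank_map sigma) -(mxrank_scale_nz _ nz_c) -QB.
exact: leq_trans (mxrankM_maxl _ _) (mxrankM_maxr _ _).
Qed.

(** Bookkeeping shared by all characteristics: index [i < n] is the class of rank [i.+1] with last
    entry 1, and index [n + j] is the second class [X j] of rank [j.+1.*2]. Ranks of distinct
    indices collide only between these two families. *)
Lemma representatives n (X : nat -> 'M[F]_n) :
    (forall j, (X j)^T = X j) ->
    (forall j, (j < n./2)%N -> \rank (X j) = j.+1.*2) ->
    (forall j, (j < n./2)%N -> ~ semisim (nf n j.*2.+1 1) (X j)) ->
    (forall A : 'M[F]_n, A^T = A -> A != 0 ->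
       (exists2 i, (i < n)%N & csim A (nf n i 1)) \/
       (exists2 j, (j < n./2)%N & csim A (X j))) ->
  exists B : 'I_(n + n./2) -> 'M[F]_n,
    [/\ forall i, B i != 0, forall i, (B i)^T = B i,
        forall i j, semisim (B i) (B j) -> semisim (B j) (B i) -> i = j
      & forall A : 'M[F]_n, A^T = A -> A != 0 -> exists i, csim A (B i)].
Proof.
move=> sX rX dX cX.
pose B (i : nat) := if (i < n)%N then nf n i 1 else X (i - n)%N.
pose rk i := if (i < n)%N then i.+1 else (i - n).+1.*2.
have rB (i : 'I_(n + n./2)) : \rank (B i) = rk i.
  have := ltn_ord i; rewrite /B /rk; case: (ltnP i n) => [lt_i _|le_i lt_i].
    by rewrite rank_nf ?oner_neq0.
  by rewrite rX //; lia.
exists B; split=> [i|i|i j ij ji|A sA nzA].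
- by rewrite -mxrank_eq0 rB /rk; case: ifP.
- by rewrite /B; case: ifP; rewrite ?tr_nf.
- have: rk i = rk j by apply/eqP; rewrite -!rB eqn_leq !semisim_rank.
  have [lt_i lt_j] := (ltn_ord i, ltn_ord j).
  rewrite /rk; case: ltnP => hi; case: ltnP => hj eij; apply: val_inj => /=.
  + lia.
  + have iE : (i : nat) = (j - n).*2.+1 by lia.
    by case: (dX (j - n)%N); [lia|move: ij; rewrite /B hi ltnNge hj -iE].
  + have jE : (j : nat) = (i - n).*2.+1 by lia.
    by case: (dX (i - n)%N); [lia|move: ji; rewrite /B hj ltnNge hi -jE].
  + lia.
- have [[i lt_i cA]|[j lt_j cA]] := cX A sA nzA.
    have hi : (i < n + n./2)%N by lia.
    by exists (Ordinal hi); rewrite /B /= lt_i.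
  have hj : (n + j < n + n./2)%N by lia.
  by exists (Ordinal hj); rewrite /B /= ltnNge leq_addr addKn.
Qed.

Lemma map_nf (sigma : {rmorphism F -> F}) n rho a :
  map_mx sigma (nf n rho a) = nf n rho (sigma a).
Proof.
rewrite /nf map_diag_mx; congr diag_mx; apply/rowP=> i; rewrite !mxE.
by case: ltngtP; rewrite ?rmorph0 ?rmorph1.
Qed.

Lemma square_char2 (a : F) : 2%:R = 0 :> F -> exists t, t ^+ 2 = a.
Proof.
move=> two; have [->|nz_a] := eqVneq a 0; first by exists 0; rewrite expr0n.
have nz_V : a^-1 != 0 by rewrite invr_eq0.
have [x [y xy]] := two_squares nz_V nz_V; exists (x + y).
rewrite sqrrD -mulr_natl two mul0r addr0; apply: (mulfI nz_V).
by rewrite mulrDr xy mulVf.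
Qed.

(** The second class of even rank is a sum of hyperbolic planes in characteristic 2, and otherwise
    the diagonal form with a nonsquare last entry. *)
Lemma symmetric_representatives n :
  exists B : 'I_(n + n./2) -> 'M[F]_n,
    [/\ forall i, B i != 0, forall i, (B i)^T = B i,
        forall i j, semisim (B i) (B j) -> semisim (B j) (B i) -> i = j
      & forall A : 'M[F]_n, A^T = A -> A != 0 -> exists i, csim A (B i)].
Proof.
have [two|two] := eqVneq (2%:R : F) 0.
  apply: (@representatives n (fun j => symp n j.+1)).
  - by move=> j; apply: tr_symp.
  - by move=> j lt_j; rewrite rank_symp //; lia.
  - move=> j lt_j [sigma [c [Q [nz_c e]]]].
    have n0 : (0 < n)%N by lia.
    (* At the first basis vector the left side of [e] vanishes while the right side is [c], because
       the first diagonal entry of the normal form is 1. *)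
    have := symp_alternating (j.+1) two (delta_mx 0 (Ordinal n0) *m Q).
    rewrite trmx_mul !mulmxA -[delta_mx 0 _ *m Q *m _]mulmxA.
    rewrite -[_ *m _ *m Q^T]mulmxA e -scalemxAr -scalemxAl map_nf row_form.
    rewrite !mxE eqxx rmorph1 scale_scalar_mx mulr1 => /eqP.
    by rewrite -scalemx1 scaler_eq0 (negbTE nz_c) (negbTE (matrix_nonzero1 _ _)).
  - move=> A sA nzA; have [aA|vA] := alternatingPn A.
      have [[|m] lt_m cA] := alternating_symp sA aA.
        by case/cong_sym: cA nzA => Q _ <-; rewrite mulmx0 mul0mx eqxx.
      by right; exists m; [lia|apply: cong_csim].
    have [rho [a [lt_rho nz_a cA]]] := nonalternating_nf sA vA.
    left; exists rho => //; apply: cong_csim; apply: cong_trans cA _.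
    have [t ta] := square_char2 a^-1 two.
    rewrite -(divff nz_a) -ta; apply: cong_nf_sqr.
    by apply: contraNneq nz_a => t0; rewrite -invr_eq0 -ta t0 expr0n.
(* Otherwise squaring would be onto, hence injective, although 1 and -1 have the same square. *)
have [e eS] : exists e, e \notin squares.
  apply/existsP; rewrite -[X in is_true X]negbK negb_exists; apply: contra two.
  move=> /forallP sqT; have /imset_injP/(_ 1 (-1)) : #|squares| == #|F|.
    by apply/eqP/eq_card => x; rewrite -[LHS]negbK sqT.
  rewrite sqrrN !inE => /(_ isT isT erefl)/eqP.
  by rewrite -subr_eq0 opprK -mulr2n.
have nz_e : e != 0.
  by apply: contraNneq eS => ->; apply/imsetP; exists 0; rewrite ?expr0n.
have nf_class rho a : a != 0 ->
    cong (nf n rho a) (nf n rho 1) \/ cong (nf n rho a) (nf n rho e).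
  move=> nz_a; have [t nz_t [] ->] := square_or eS nz_a; [left|right].
    by apply: cong_sym; rewrite -[t ^+ 2]mul1r; apply: cong_nf_sqr.
  by apply: cong_sym; apply: cong_nf_sqr.
apply: (@representatives n (fun j => nf n j.*2.+1 e)).
- by move=> j; apply: tr_nf.
- by move=> j lt_j; rewrite rank_nf //; lia.
(* The rank is even, so the discriminants differ by an even power of [c] up to squares, and [e]
   would be a square. *)
- move=> j lt_j [sigma [c [Q [nz_c]]]]; rewrite map_nf rmorph1.
  case/nf_det => [|d de]; first by lia.
  have nz_d : d != 0.
    apply: contraTneq (expf_neq0 j.*2.+2 nz_c) => d0.
    by rewrite -[_ ^+ _]mulr1 -de d0 expr0n mul0r eqxx.
  case/imsetP: eS; exists (c ^+ j.+1 / d) => //.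
  rewrite expr_div_n -exprM muln2 doubleS -[c ^+ _]mulr1 -de mulrAC mulfV ?mul1r //.
  by rewrite expf_neq0.
- move=> A sA nzA; have [aA|vA] := alternatingPn A.
    by case/eqP: nzA; apply: alternating_eq0.
  have [rho [a [lt_rho nz_a cA]]] := nonalternating_nf sA vA.
  have [cn|cn] := nf_class rho a nz_a.
    by left; exists rho => //; apply/cong_csim/(cong_trans cA).
  (* Odd [rho] means even rank, where the last entry [e] gives the second class. In odd rank,
     scaling by [e] must identify both classes. *)
  have := odd_double_half rho; case: (odd rho) => /= rhoE.
    right; exists rho./2; first by lia.
    by apply/cong_csim/(cong_trans cA); rewrite add1n in rhoE; rewrite rhoE.
  left; exists rho => //; apply: csim_trans (cong_csim (cong_trans cA cn)) _.
  have [aB|vB] := alternatingPn (e *: nf n rho 1).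
    have /eqP : e *: nf n rho 1 = 0.
      by apply: alternating_eq0 aB => //; rewrite linearZ /= tr_nf.
    by rewrite -mxrank_eq0 mxrank_scale_nz ?rank_nf ?oner_neq0.
  have [|rho' [b [lt_rho' nz_b cB]]] := nonalternating_nf _ vB.
    by rewrite linearZ /= tr_nf.
  have rhoE' : rho' = rho.
    have := cong_rank cB.
    by rewrite mxrank_scale_nz ?rank_nf ?oner_neq0 // => -[].
  rewrite {rho' lt_rho'}rhoE' in cB.
  (* If the scaled form had last entry 1, [nf_det] would make an odd power of [e^-1] a square, hence
     [e] itself. *)
  have [cb|cb] := nf_class rho b nz_b; have := cong_trans cB cb; last first.
    by move=> /cong_sym; exists e.
  move=> /(cong_scale e^-1); rewrite scalerA mulVf // scale1r.
  move=> [Q _ /nf_det [|d]] //; rewrite !mulr1 => de.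
  case/imsetP: eS; exists (e ^+ rho./2.+1 * d) => //.
  rewrite exprMn de -exprM muln2 -rhoE add0n doubleS exprVn doubleK.
  by rewrite [e ^+ _.+2]exprS mulfK // expf_neq0.
Qed.

(** * Removing zero rows within a congruence class *)

(** The matrix [1%:M + N] adds a fixed nonzero row [k] to every zero row. Since row [k] itself is
    left alone, [N] squares to 0; the invertible factor on the right keeps rows nonzero. *)
Lemma cong_compatible n (A : 'M[F]_n) :
  A != 0 -> exists2 B, cong A B & forall i, exists j, B i j != 0.
Proof.
move=> /matrix0Pn[k [l nz]].
pose v : 'cV[F]_n := \col_i (row i A == 0)%:R.
pose N := v *m (delta_mx 0 k : 'rV_n).
have vk : v k 0 = 0.
  rewrite mxE; case: eqP => // /rowP /(_ l); rewrite !mxE => e.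
  by rewrite e eqxx in nz.
have NN : N *m N = 0.
  rewrite /N -mulmxA [delta_mx 0 k *m _]mulmxA -rowE.
  rewrite (_ : row k v = 0) ?mul0mx ?mulmx0 //.
  by apply/rowP=> j; rewrite !ord1 mxE vk mxE.
have uP : 1%:M + N \in unitmx.
  have /mulmx1_unit[] // : (1%:M + N) *m (1%:M - N) = 1%:M.
  by rewrite mulmxBr mulmx1 mulmxDl mul1mx NN addr0 addrK.
exists ((1%:M + N) *m A *m (1%:M + N)^T); first by exists (1%:M + N).
move=> i; apply/existsP.
have nz_row : row i ((1%:M + N) *m A) != 0.
  rewrite mulmxDl mul1mx raddfD /= /N -mulmxA -rowE.
  rewrite [row i (v *m _)]rowE mulmxA -rowE [row i v]mx11_scalar !mxE mul_scalar_mx.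
  have [r0|nr] := eqVneq (row i A) 0; last by rewrite scale0r addr0.
  rewrite r0 add0r scale1r; apply: contraNneq nz => /rowP /(_ l).
  by rewrite !mxE => ->.
have : row i ((1%:M + N) *m A *m (1%:M + N)^T) != 0.
  rewrite row_mul; apply: contraNneq nz_row => r0.
  have uT : (1%:M + N)^T \in unitmx by rewrite unitmx_tr.
  by rewrite -[row i _](mulmxK uT) r0 mul0mx.
by move=> /matrix0Pn[i' [j]]; rewrite mxE => h; apply/existsP; exists j.
Qed.

Lemma semisim_cong n (A A' B B' : 'M[F]_n) :
  cong A A' -> cong B B' -> semisim A' B' -> semisim A B.
Proof.
move=> /cong_sym[P uP <-] [R _ <-] [sigma [c [Q [nz_c QB]]]].
exists sigma, c, (map_mx sigma P *m Q *m R); split=> //.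
by rewrite !map_mxM scalemxAl scalemxAr -QB !trmx_mul map_trmx !mulmxA.
Qed.
End SymmetricForms.

(** * The rings of Construction A *)

Section ConstructionA.
Set Implicit Arguments.
Unset Strict Implicit.
Unset Printing Implicit Defensive.
Import GRing.Theory.
Local Open Scope ring_scope.

Lemma ring_iso_sym (R S : nzRingType) : ring_iso R S -> ring_iso S R.
Proof.
move=> [f [g fK gK]].
have gZ : zmod_morphism g by move=> x y; apply: (can_inj fK); rewrite rmorphB !gK.
have gM : monoid_morphism g.
  by split=> [|x y]; apply: (can_inj fK); rewrite ?rmorph1 ?rmorphM !gK.
pose gz := GRing.isZmodMorphism.Build _ _ g gZ.
pose gm := GRing.isMonoidMorphism.Build _ _ g gM.
pose gr : {rmorphism S -> R} := HB.pack g gz gm.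
by exists gr; exists f.
Qed.

Lemma ring_iso_trans (R S T : nzRingType) :
  ring_iso R S -> ring_iso S T -> ring_iso R T.
Proof.
by move=> [f bf] [g bg]; exists (g \o f : {rmorphism R -> T}); apply: bij_comp.
Qed.

Section GeneralT.
Variables (F : finFieldType) (s t lam : nat).
Implicit Types A B : t.-tuple 'M[F]_s.

(** [emb] includes the coefficient field and [res] is the residue map, whose kernel is U + N. *)
Definition emb A (a : F) : constrA lam A := (a, 0, 0).
Definition res A (x : constrA lam A) : F := x.1.1.

Lemma constrAM A (a b : F) u v w z :
  ((a, u, w) : constrA lam A) * (b, v, z) =
  (a * b, a *: v + b *: u, a *: z + b *: w + uprod lam A u v).
Proof. by []. Qed.

Fact emb_zmod A : zmod_morphism (emb A).
Proof. by move=> a b; rewrite /emb; congr (_, _, _); rewrite ?subr0. Qed.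

Fact emb_monoid A : monoid_morphism (emb A).
Proof.
split=> // a b; rewrite /emb constrAM !scaler0 !addr0.
by rewrite uprod0l addr0.
Qed.

HB.instance Definition _ A := GRing.isZmodMorphism.Build _ _ (emb A) (emb_zmod A).
HB.instance Definition _ A :=
  GRing.isMonoidMorphism.Build _ _ (emb A) (emb_monoid A).

Fact res_zmod A : zmod_morphism (@res A). Proof. by []. Qed.
Fact res_monoid A : monoid_morphism (@res A).
Proof. by split=> // -[[a u] w] [[b v] z]. Qed.

HB.instance Definition _ A := GRing.isZmodMorphism.Build _ _ (@res A) (@res_zmod A).
HB.instance Definition _ A :=
  GRing.isMonoidMorphism.Build _ _ (@res A) (@res_monoid A).

Lemma res0_mul A (x y : constrA lam A) :
  res x = 0 -> res y = 0 -> x * y = (0, 0, uprod lam A x.1.2 y.1.2).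
Proof.
case: x y => [[a u] w] [[b v] z]; rewrite /res /= => -> ->.
by rewrite constrAM mul0r !scale0r !addr0 add0r.
Qed.

Lemma res0_mul3 A (x y z : constrA lam A) :
  res x = 0 -> res y = 0 -> res z = 0 -> x * y * z = 0.
Proof.
move=> x0 y0 z0; have xy0 : res (x * y) = 0 by rewrite rmorphM /= x0 mul0r.
by rewrite res0_mul // res0_mul //= uprod0l.
Qed.

(** Nilpotency describes the kernel of [res] in purely ring-theoretic terms, so ring morphisms
    preserve it even when they are not linear over [F]. *)
Lemma res_nilpotent A (x : constrA lam A) : res x = 0 <-> x ^+ 3 = 0.
Proof.
split=> [x0|/(congr1 (@res A))]; first by rewrite !exprS expr0 mulr1 mulrA res0_mul3.
by rewrite rmorphXn rmorph0 /= => /eqP; rewrite expf_eq0 => /eqP.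
Qed.

Lemma emb_mul A (a b : F) u w :
  emb A a * (b, u, w) = (a * b, a *: u, a *: w).
Proof. by rewrite constrAM !scaler0 !addr0 uprod0l addr0. Qed.

(** If the residue is nonzero, the components of a cofactor vanish one after another. If it is zero,
    any element of N annihilates, and [0 < t] provides a nonzero one. *)
Lemma constrA_zero_divisor A (x : constrA lam A) :
  (0 < t)%N -> zero_divisor x <-> res x = 0.
Proof.
case: x => [[a u] w] t0; rewrite /res /=; split=> [[[[b v] z] nz_y]|->].
  have [//|nz_a] := eqVneq a 0; case; rewrite constrAM => -[] ab0;
    have -> : b = 0
      by apply/eqP; move/eqP: ab0; rewrite mulf_eq0 (negbTE nz_a) ?orbF.
    rewrite !scale0r !addr0 => /eqP.
    rewrite scaler_eq0 (negbTE nz_a) /= => /eqP v0; move: nz_y.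
    rewrite v0 uprod0r addr0 => nz_y /eqP.
    rewrite scaler_eq0 (negbTE nz_a) /= => /eqP z0; case/eqP: nz_y.
    by move/eqP: ab0; rewrite mulf_eq0 (negbTE nz_a) /= => /eqP ->; rewrite z0.
  rewrite !scale0r !add0r => /eqP.
  rewrite scaler_eq0 (negbTE nz_a) /= => /eqP v0; move: nz_y.
  rewrite v0 uprod0l addr0 => nz_y /eqP.
  rewrite scaler_eq0 (negbTE nz_a) /= => /eqP z0; case/eqP: nz_y.
  by move/eqP: ab0; rewrite mulf_eq0 (negbTE nz_a) orbF => /eqP ->; rewrite z0.
exists (0, 0, const_mx 1); last first.
  by left; rewrite constrAM !(mul0r, scale0r, scaler0, addr0, uprod0r).
apply/eqP => -[] /matrixP /(_ 0 (lshift lam (Ordinal t0))).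
by rewrite !mxE => /eqP; rewrite oner_eq0.
Qed.

Lemma uprod_delta A i j k :
  uprod lam A (delta_mx 0 i) (delta_mx 0 j) 0 (lshift lam k) = tnth A k i j.
Proof.
rewrite /uprod row_mxEl mxE (bigD1 i) //= (bigD1 j) //= !mxE !eqxx /= mul1r mul1r.
rewrite !big1 ?addr0 // => [i' /negbTE ni|j' /negbTE nj].
  by rewrite big1 // => j' _; rewrite !mxE ni andbF !mul0r.
by rewrite !mxE nj andbF mulr0 mul0r.
Qed.

Lemma constrA_property_T A :
  (0 < t)%N -> (exists k, tnth A k != 0) -> property_T (constrA lam A).
Proof.
move=> t0 [k /matrix0Pn[i [j nz]]].
have zd (x : constrA lam A) := constrA_zero_divisor x t0.
split; first split.
- by apply/zd.
- by move=> x y /zd x0 /zd y0; apply/zd; rewrite rmorphB /= x0 y0 subrr.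
- by move=> a x /zd x0; split; apply/zd; rewrite rmorphM /= x0 ?mulr0 ?mul0r.
- by move=> x y z /zd x0 /zd y0 /zd z0; apply: res0_mul3.
exists (0, delta_mx 0 i, 0), (0, delta_mx 0 j, 0); split; try by apply/zd.
rewrite res0_mul //; apply/eqP => -[] /matrixP /(_ 0 (lshift lam k)).
by rewrite uprod_delta mxE => /eqP; rewrite (negbTE nz).
Qed.

Lemma constrA_commutative A :
  (forall k, (tnth A k)^T = tnth A k) ->
  commutative (@GRing.mul (constrA lam A)).
Proof.
move=> sA [[a u] w] [[b v] z]; rewrite !constrAM; congr (_, _, _).
- exact: mulrC.
- exact: addrC.
rewrite [X in X + _]addrC; congr (_ + _); rewrite /uprod; congr row_mx.
apply/rowP=> k; rewrite !mxE exchange_big; apply: eq_bigr => i _.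
apply: eq_bigr => j _; rewrite [u 0 j * _]mulrC; congr (_ * _).
by rewrite -[in LHS]sA mxE.
Qed.

Lemma constrA_max_galois_subfield A :
  has_max_galois_subfield F (constrA lam A).
Proof.
exists (emb A : {rmorphism F -> constrA lam A}); split.
  split.
  - split.
    + by apply/imsetP; exists 1; rewrite ?rmorph1.
    + move=> _ _ /imsetP[a _ ->] /imsetP[b _ ->]; apply/imsetP.
      by exists (a - b); rewrite ?rmorphB.
    + move=> _ _ /imsetP[a _ ->] /imsetP[b _ ->]; apply/imsetP.
      by exists (a * b); rewrite ?rmorphM.
  - move=> _ _ /imsetP[a _ ->] /imsetP[b _ ->].
    by rewrite -!rmorphM mulrC.
  - move=> _ /imsetP[a _ ->] nz_a; exists (emb A a^-1).
      by apply/imsetP; exists a^-1.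
    rewrite -rmorphM divff ?rmorph1 //.
    by apply: contraNneq nz_a => ->; rewrite rmorph0.
move=> L [[L1 LB LM] _ Linv] sFL; apply/eqP; rewrite eqEsubset sFL andbT.
apply/subsetP=> x Lx; apply/imsetP; exists (res x) => //.
(* This difference has residue 0, so it cannot be invertible and must vanish in the field [L]. *)
have Ly : x - emb A (res x) \in L.
  by apply: LB => //; apply: (subsetP sFL); apply: imset_f.
have [/eqP|nz_y] := eqVneq (x - emb A (res x)) 0.
  by rewrite subr_eq0 => /eqP.
have [z _ /(congr1 (@res A))] := Linv _ Ly nz_y.
rewrite rmorphM rmorphB /= [res (emb _ _)]/(res _) subrr mul0r rmorph1 => /eqP.
by rewrite eq_sym oner_eq0.
Qed.

End GeneralT.

(** * Isomorphisms between rings given by a single matrix *)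

Section OneMatrix.
Variables (F : finFieldType) (s lam : nat).
Implicit Types A B : 1.-tuple 'M[F]_s.

Lemma uprod1 A u v :
  uprod lam A u v = row_mx (u *m tnth A 0 *m v^T) 0.
Proof.
rewrite /uprod; congr row_mx; apply/rowP=> k; rewrite !ord1 !mxE exchange_big.
apply: eq_bigr => j _; rewrite !mxE mulr_suml; apply: eq_bigr => i _.
by rewrite mulrAC.
Qed.

Lemma ring_iso_of_form A B (d : F) Q :
    d != 0 -> Q \in unitmx -> Q *m tnth B 0 *m Q^T = d *: tnth A 0 ->
  ring_iso (constrA lam A) (constrA lam B).
Proof.
move=> nz_d uQ QB.
pose f (x : constrA lam A) : constrA lam B :=
  (x.1.1, x.1.2 *m Q, d *: x.2).
pose g (x : constrA lam B) : constrA lam A :=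
  (x.1.1, x.1.2 *m invmx Q, d^-1 *: x.2).
have fZ : zmod_morphism f.
  by move=> [[a u] w] [[b v] z]; rewrite /f /=; congr (_, _, _);
     rewrite ?mulmxBl ?scalerBr.
have fM : monoid_morphism f.
  split=> [|[[a u] w] [[b v] z]]; first by rewrite /f /= mul0mx scaler0.
  rewrite /f !constrAM /=; congr (_, _, _).
    by rewrite mulmxDl -!scalemxAl.
  rewrite !scalerDr !scalerA ![_ * d]mulrC; congr (_ + _).
  rewrite !uprod1 scale_row_mx scaler0; congr row_mx.
  rewrite trmx_mul !mulmxA -[u *m Q *m _]mulmxA -[u *m _ *m Q^T]mulmxA QB.
  by rewrite -scalemxAr -scalemxAl.
pose fz := GRing.isZmodMorphism.Build _ _ f fZ.
pose fm := GRing.isMonoidMorphism.Build _ _ f fM.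
pose fr : {rmorphism constrA lam A -> constrA lam B} := HB.pack f fz fm.
exists fr, g => [[[a u] w]|[[a u] w]]; rewrite /= /f /g /=.
  by rewrite mulmxK // scalerA mulVf // scale1r.
by rewrite mulmxKV // scalerA mulfV // scale1r.
Qed.

Lemma ring_iso_of_csim A B :
  csim (tnth A 0) (tnth B 0) -> ring_iso (constrA lam A) (constrA lam B).
Proof.
move=> [c nz_c [P uP PA]].
apply: (@ring_iso_of_form A B c^-1 (invmx P)); rewrite ?invr_eq0 ?unitmx_inv //.
apply: (scalerI nz_c); rewrite scalerA divff // scale1r.
rewrite scalemxAl scalemxAr -PA trmx_inv !mulmxA mulVmx // mul1mx mulmxK //.
by rewrite unitmx_tr.
Qed.

(** Products of elements of U are multiples of [e], which [f] sends to [c] times its counterpart.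
    Comparing the images of products of basis vectors, modulo N in each factor, gives the
    relation. *)
Lemma semisim_of_ring_iso A B :
    tnth A 0 != 0 -> ring_iso (constrA lam A) (constrA lam B) ->
  semisim (tnth A 0) (tnth B 0).
Proof.
move=> /matrix0Pn[i0 [j0 nz0]] [f /bij_inj injf].
have res_f x : res x = 0 -> res (f x) = 0.
  by move/res_nilpotent => x3; apply/res_nilpotent; rewrite -rmorphXn x3 rmorph0.
(* [f] may move the coefficient field, so only the map induced on residues is retained; by [f_emb]
   it governs the action on N. *)
pose sigma : {rmorphism F -> F} := @res _ _ _ _ B \o (f \o emb lam A).
pose iota (u : 'rV[F]_s) : constrA lam A := (0, u, 0).
pose e : constrA lam A := (0, 0, row_mx 1%:M 0).
pose phi u := (f (iota u)).1.2.
have iotaM u v :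
    iota u * iota v = emb lam A ((u *m tnth A 0 *m v^T) 0 0) * e.
  rewrite res0_mul // emb_mul mulr0 scaler0 uprod1 scale_row_mx scaler0.
  by rewrite scale_scalar_mx mulr1 -mx11_scalar.
have f_iotaM u v :
    f (iota u * iota v) = (0, 0, row_mx (phi u *m tnth B 0 *m (phi v)^T) 0).
  by rewrite rmorphM res0_mul ?res_f // uprod1.
have f_emb a w : f (emb lam A a) * (0, 0, w) = (0, 0, sigma a *: w).
  rewrite [sigma a]/(res (f (emb lam A a))); case: (f _) => [[b u] z].
  by rewrite constrAM !(mulr0, scale0r, scaler0, uprod0r, addr0).
pose u_ i : 'rV[F]_s := delta_mx 0 i.
have formE i j : (u_ i *m tnth A 0 *m (u_ j)^T) 0 0 = tnth A 0 i j.
  by rewrite row_form mxE eqxx.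
(* Since [e] is itself a scaled product of two elements of U, its image has no component in the last
   [lam] coordinates. *)
have [c fe] : exists c, f e = (0, 0, row_mx c%:M 0).
  have eE : e = emb lam A (tnth A 0 i0 j0)^-1 *
      (iota (u_ i0) * iota (u_ j0)).
    by rewrite iotaM formE mulrA -rmorphM mulVf // rmorph1 mul1r.
  rewrite eE rmorphM f_iotaM f_emb scale_row_mx scaler0.
  set X := _ *: _; exists (X 0 0); by rewrite -mx11_scalar.
have nz_c : c != 0.
  apply/eqP => c0; have : f e = f 0 by rewrite fe c0 raddf0 row_mx0 rmorph0.
  move/injf => -[] /matrixP /(_ 0 (lshift lam 0)).
  by rewrite row_mxEl !mxE => /eqP; rewrite oner_eq0.
exists sigma, c, (\matrix_i phi (u_ i)); split=> //.
apply/matrixP=> i j.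
have := f_iotaM (u_ i) (u_ j).
rewrite iotaM formE rmorphM fe f_emb scale_row_mx => -[] /eq_row_mx[h _].
have := congr1 (fun M : 'M_1 => M 0 0) h.
rewrite scale_scalar_mx [LHS]mxE eqxx mulr1n => hij.
rewrite [RHS]mxE [X in _ * X]mxE mulrC hij !mxE.
apply: eq_bigr => k _; rewrite !mxE; congr (_ * _).
by apply: eq_bigr => l _; rewrite !mxE.
Qed.
End OneMatrix.

End ConstructionA.

(** * Counting the isomorphism classes *)

Theorem proposition5p7 (p r s lam : nat) (F : finFieldType)
  (hp : prime p) (hr : (1 <= r)%N) (hs : (1 < s)%N) (hF : #|F| = (p ^ r)%N) :
  num_iso_classes (comm_T_ring p F (1 + s + 1 + lam)%N s 1 lam)
    (if odd s then (3 * s - 1) %/ 2 else (3 * s) %/ 2).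
Proof.
have -> : (if odd s then (3 * s - 1) %/ 2 else (3 * s) %/ 2) = s + s./2.
  by have := odd_double_half s; case: odd; lia.
have [B [nzB sB B_inj B_all]] := symmetric_representatives F s.
(* The representatives are replaced by congruent matrices without zero rows, which makes them
   compatible. *)
have [C cBC C_rows] := fin_all_exists2 (fun i => cong_compatible (nzB i)).
have nzC i : C i != 0%R by rewrite -mxrank_eq0 (cong_rank (cBC i)) mxrank_eq0.
pose tC i : 1.-tuple 'M[F]_s := [tuple C i].
exists (fun i => constrA lam (tC i) : finNzRingType); split=> [i|i j ij|R].
- have sC k : (tnth (tC i) k)^T%R = tnth (tC i) k.
    by rewrite ord1; apply: cong_tr (cBC i) (sB i).
  split.
  + exact: constrA_commutative.
  + by apply: constrA_property_T => //; exists ord0; exact: nzC.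
  + exact: (GRing.rmorph_pchar (emb lam (tC i)) (card_finPcharP hF hp)).
  + exact: constrA_max_galois_subfield.
  + split; [lia|by []|by []|exists (tC i); split=> //].
      split; first by rewrite seq1_free.
      by move=> k; have [l Ckl] := C_rows i k; exists l, ord0; left.
    by exists idfun, idfun.
(* An isomorphism and its inverse give [semisim] in both directions, first for the [C i] and then
   for the [B i]. *)
- apply: B_inj; apply: semisim_cong (cBC _) (cBC _) _.
    exact: (@semisim_of_ring_iso _ _ lam (tC i) (tC j) (nzC i) ij).
  exact: (@semisim_of_ring_iso _ _ lam (tC j) (tC i) (nzC j) (ring_iso_sym ij)).
- move=> [_ _ _ _ [_ _ _ [A [[fA _] sA isoA]]]].
  have nzA : tnth A ord0 != 0%R.
    move: fA; case/tupleP: A {sA isoA} => a A; rewrite (tuple0 A) /=.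
    by rewrite seq1_free.
  have [i cA] := B_all _ (sA ord0) nzA.
  exists i; apply: ring_iso_trans isoA _; apply: ring_iso_of_csim.
  exact: csim_trans cA (cong_csim (cBC i)).
Qed.
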